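(* Let $m,n\geq 1$ be integers with $|s_n|\leq m<|s_{n+1}|$ and suppose $m\notin\bigcup_{i=1}^{k}\mathcal{D}_i(n)$, where $\mathcal{D}_1(n)=\{r|s_n| : 1\leq r\leq d_{n+1}\}$, $\mathcal{D}_i(n)=\{|s_n^r s_{n-1}^{d_n}\cdots s_{n+2-i}^{d_{n+3-i}}s_{n+1-i}| : 1\leq r\leq d_{n+1}\}$ for $2\leq i\leq k-1$, and $\mathcal{D}_k(n)=\{|s_n^r s_{n-1}^{d_n}\cdots s_{n+2-k}^{d_{n+3-k}}s_{n+1-k}| : 1\leq r\leq d_{n+1}-1\}$. Then $p(m;l)=0$ for all integers $l\geq 2$, i.e., there is no word $w$ of length $m$ such that $w^l$ is a factor of $\mathbf{s}$.
   Context: Fix $k\geq 2$ and the alphabet $\mathcal{A}_k=\{a_1,\dots,a_k\}$. An infinite word $\mathbf{t}$ is standard episturmian with directive word $x_1x_2x_3\cdots$ ($x_i$ letters) if its palindromic prefixes $u_1=\varepsilon,u_2,\dots$ satisfy $u_{n+1}=(u_nx_n)^{(+)}$, where $w^{(+)}$ is the shortest palindrome having $w$ as a prefix, and $\mathbf{t}=\lim_n u_n$. Let $(d_i)_{i\geq1}$ be positive integers and let $\mathbf{s}$ be the standard episturmian word with directive word $a_1^{d_1}a_2^{d_2}\cdots a_k^{d_k}a_1^{d_{k+1}}a_2^{d_{k+2}}\cdots a_k^{d_{2k}}a_1^{d_{2k+1}}\cdots$. Define words $s_{1-k}=a_2, s_{2-k}=a_3,\dots,s_{-1}=a_k, s_0=a_1$;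 $s_n=s_{n-1}^{d_n}s_{n-2}^{d_{n-1}}\cdots s_0^{d_1}a_{n+1}$ for $1\leq n\leq k-1$; and $s_n=s_{n-1}^{d_n}s_{n-2}^{d_{n-1}}\cdots s_{n-k+1}^{d_{n-k+2}}s_{n-k}$ for $n\geq k$. For integers $m\geq 1$, $l\geq2$, $p(m;l)$ denotes the number of words $w$ over $\mathcal{A}_k$ with $|w|=m$ such that $w^l=ww\cdots w$ ($l$ times) is a factor of $\mathbf{s}$. *)

(* Defs.v *)
From mathcomp Require Import all_boot all_order all_algebra.
From mathcomp Require Import boolp.

Set Implicit Arguments.
Unset Strict Implicit.
Unset Printing Implicit Defensive.

Import GRing.Theory.

Definition wpow (T : Type) (w : seq T) (l : nat) : seq T := flatten (nseq l w).

(* Infinite words are functions on nat, so positions are numbered from 0. *)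
Definition is_factor (T : Type) (w : seq T) (t : nat -> T) : Prop :=
  exists i, w = [seq t (i + j) | j <- iota 0 (size w)].

Definition palindrome (T : Type) (w : seq T) : Prop := rev w = w.

Definition is_pal_closure (T : eqType) (w v : seq T) : Prop :=
  [/\ palindrome v, prefix w v
    & forall v', palindrome v' -> prefix w v' -> size v <= size v'].

Definition word_limit (T : Type) (u : nat -> seq T) (t : nat -> T) : Prop :=
  forall N, exists n0, forall n, n0 <= n ->
    N <= size (u n) /\ take N (u n) = mkseq t N.

(* The palindromic prefix u_(n+1) is [u n] and the letter x_(n+1) is [x n].
   That the [u n] are all the palindromic prefixes of [t], in increasing order
   of length, is [standard_episturmian_palindromes] below. *)
Definition standard_episturmian (T : eqType) (x t : nat -> T) : Prop :=
  exists u : nat -> seq T,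
    [/\ u 0 = [::],
        forall n, is_pal_closure (rcons (u n) (x n)) (u n.+1),
        forall n, palindrome (u n) /\ u n = mkseq t (size (u n))
      & word_limit u t].

Section Words.

Variables (k : nat) (hk : 1 < k) (d : nat -> nat).

(* The letter a_(i+1); the index is read modulo k, so that
   [letter k] = a_(k+1) is a_1 again. *)
Definition letter (i : nat) : 'I_k := Ordinal (ltn_pmod i (ltnW hk)).

(* a_1^(d_1) a_2^(d_2) ... ; position i lies in one of the first i+1 blocks
   because every d_j with j >= 1 is positive. *)
Definition directive (i : nat) : 'I_k :=
  nth (letter 0) (flatten [seq nseq (d j) (letter j.-1) | j <- iota 1 i.+1]) i.

(* d_j extended by 0 to all j <= 0; the value [d 0] is never used. *)
Definition dz (j : int) : nat :=
  match j with Posz j'.+1 => d j'.+1 | _ => 0 end.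

(* [s_list n] is [:: s_n; s_(n-1); ...; s_0]. *)
Fixpoint s_list (n : nat) : seq (seq 'I_k) :=
  match n with
  | 0 => [:: [:: letter 0]]
  | n'.+1 =>
      let p := s_list n' in
      (flatten [seq wpow (nth [::] p j) (d (n'.+1 - j))
               | j <- iota 0 (minn n'.+1 k.-1)]
       ++ (if n'.+1 < k then [:: letter n'.+1] else nth [::] p k.-1)) :: p
  end.

(* s_n for all n >= 1 - k; [Negz j] is -(j+1) and s_(-(j+1)) = a_(k-j).
   The equations defining these words are [sword_neg], [sword0],
   [sword_small] and [sword_large] below. *)
Definition sword (n : int) : seq 'I_k :=
  match n with
  | Posz n' => head [::] (s_list n')
  | Negz j => [:: letter (k - j.+1)]
  end.

(* s_(n-1)^(d_n) s_(n-2)^(d_(n-1)) ... s_(n-c)^(d_(n-c+1)) *)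
Definition sprod (n c : nat) : seq 'I_k :=
  flatten [seq wpow (sword (n%:Z - j%:Z)%R) (dz (n%:Z + 1 - j%:Z)%R)
          | j <- iota 1 c].

(* The set D_i(n), 1 <= i <= k. *)
Definition Dset (i n : nat) : seq nat :=
  let len r := size (wpow (sword n) r ++ sprod n (i - 2)
                     ++ sword (n%:Z + 1 - i%:Z)%R) in
  if i == 1 then [seq r * size (sword n) | r <- iota 1 (d n.+1)]
  else if i < k then [seq len r | r <- iota 1 (d n.+1)]
  else [seq len r | r <- iota 1 (d n.+1 - 1)].

(* p(m;l) *)
Definition num_powers (t : nat -> 'I_k) (m l : nat) : nat :=
  #|[set w : m.-tuple 'I_k | `[< is_factor (wpow w l) t >]]|.

Lemma nth_s_list n j : j <= n -> nth [::] (s_list n) j = sword (n - j)%N.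
Proof.
elim: n j => [|n IHn] [|j] //= le_jn.
by rewrite subSS IHn.
Qed.

Lemma swordS n :
  sword n.+1 =
    flatten [seq wpow (nth [::] (s_list n) j) (d (n.+1 - j))
            | j <- iota 0 (minn n.+1 k.-1)]
    ++ (if n.+1 < k then [:: letter n.+1] else nth [::] (s_list n) k.-1).
Proof. by []. Qed.

Lemma sword_neg j : 0 < j < k -> sword (j%:Z - k%:Z)%R = [:: letter j].
Proof.
case/andP=> j0 jk.
have -> : (j%:Z - k%:Z)%R = Negz (k - j).-1.
  by rewrite NegzE prednK ?subn_gt0 // -subzn ?(ltnW jk) // opprB.
by rewrite /= prednK ?subn_gt0 // subKn // ltnW.
Qed.

Lemma sword0 : sword 0 = [:: letter 0].
Proof. by []. Qed.

Lemma sprodE n c : c <= n ->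
  sprod n c = flatten [seq wpow (sword (n - j.+1)%N) (d (n - j))
                      | j <- iota 0 c].
Proof.
move=> le_cn; rewrite /sprod -[1]addn0 iotaDl -map_comp; congr flatten.
apply/eq_in_map => j; rewrite mem_iota add0n => /andP[_ jc] /=.
have jn : j < n by apply: leq_trans jc le_cn.
rewrite subzn // -[(n%:Z + 1)%R]/(Posz (n + 1)) addn1 subzn ?ltnS 1?ltnW //.
by rewrite add1n subSS -[n - j]prednK ?subn_gt0.
Qed.

Lemma sword_small n : 1 <= n <= k - 1 ->
  sword n = sprod n n ++ [:: letter n].
Proof.
case: n => // n /andP[_ le_nk]; rewrite sprodE // swordS.
have lt_nk : n.+1 < k by rewrite -(prednK (ltnW hk)) ltnS -subn1.
have -> : minn n.+1 k.-1 = n.+1 by apply/minn_idPl; rewrite -subn1.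
rewrite lt_nk; congr (flatten _ ++ _).
apply/eq_in_map => j; rewrite mem_iota add0n => /andP[_ jn] /=.
by rewrite nth_s_list // subSS.
Qed.

Lemma sword_large n : k <= n ->
  sword n = sprod n (k - 1) ++ sword (n%:Z - k%:Z)%R.
Proof.
case: n => [|n] le_kn; first by have := leq_trans hk le_kn.
have k0 : 0 < k by apply: ltnW.
rewrite sprodE; last by apply: leq_trans le_kn; rewrite leq_subr.
have le_kn1 : k.-1 <= n by rewrite -ltnS prednK.
have eqm : minn n.+1 k.-1 = k.-1 by apply/minn_idPr; rewrite (leq_trans le_kn1).
rewrite swordS ltnNge le_kn eqm subn1.
rewrite subzn // nth_s_list // -[in (n.+1 - k)](prednK k0) subSS.
congr (flatten _ ++ _); apply/eq_in_map => j.
rewrite mem_iota add0n => /andP[_ jk] /=.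
by rewrite nth_s_list ?subSS // ltnW // (leq_trans jk).
Qed.

End Words.

Section Episturmian.

Variable T : eqType.

Lemma pal_closure_exists (w : seq T) : exists v, is_pal_closure w v.
Proof.
pose P n := `[< exists v, [/\ palindrome v, prefix w v & size v = n] >].
have exP : exists n, P n.
  exists (size (w ++ rev w)); apply/asboolP; exists (w ++ rev w).
  by rewrite /palindrome rev_cat revK prefix_prefix.
case: (ex_minnP exP) => n /asboolP[v [pv wv <-]] minv.
exists v; split=> // v' pv' wv'; apply: minv; apply/asboolP.
by exists v'.
Qed.

Lemma standard_episturmian_exists (x : nat -> T) :
  exists t, standard_episturmian x t.
Proof.
pose cl w : seq T := projT1 (cid (pal_closure_exists w)).
have clP w : is_pal_closure w (cl w) by rewrite /cl; case: cid.
pose u := fix u n := if n is m.+1 then cl (rcons (u m) (x m)) else [::].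
have uS n : is_pal_closure (rcons (u n) (x n)) (u n.+1) by apply: clP.
have preS n : prefix (u n) (u n.+1).
  have [_ pu _] := uS n; apply: prefix_trans pu.
  by rewrite prefix_rcons.
have pre m n : m <= n -> prefix (u m) (u n).
  elim: n => [|n IHn]; first by rewrite leqn0 => /eqP->; apply: prefix_refl.
  rewrite leq_eqVlt => /predU1P[->|/IHn h]; first exact: prefix_refl.
  exact: prefix_trans h (preS n).
have szu n : n <= size (u n).
  elim: n => // n IHn; have [_ /size_prefix pu _] := uS n.
  by apply: leq_trans pu; rewrite size_rcons.
pose t i := nth (x 0) (u i.+1) i.
have tu n i : i < size (u n) -> nth (x 0) (u n) i = t i.
  move=> lin; rewrite /t.
  case: (leqP n i.+1) => [/pre|/ltnW/pre] /prefixP[v ->].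
    by rewrite nth_cat lin.
  by rewrite nth_cat szu.
have takeu n N : N <= size (u n) -> take N (u n) = mkseq t N.
  move=> leN; apply: (@eq_from_nth _ (x 0)).
    by rewrite size_mkseq size_takel.
  move=> i; rewrite size_takel // => iN.
  by rewrite nth_take // nth_mkseq // tu // (leq_trans iN).
exists t, u; split=> //.
- move=> n; split; last by rewrite -(takeu n) // take_size.
  by case: n => // n; have [] := uS n.
- move=> N; exists N => n leNn; have le := leq_trans leNn (szu n).
  by split=> //; apply: takeu.
Qed.

Lemma standard_episturmian_palindromes (x t : nat -> T) (u : nat -> seq T) :
  u 0 = [::] ->
  (forall n, is_pal_closure (rcons (u n) (x n)) (u n.+1)) ->
  (forall n, u n = mkseq t (size (u n))) ->
  (forall n, size (u n) < size (u n.+1)) /\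
  (forall N, palindrome (mkseq t N) -> exists n, mkseq t N = u n).
Proof.
move=> u0 uS ut.
have szS n : size (u n) < size (u n.+1).
  by have [_ /size_prefix + _] := uS n; rewrite size_rcons.
have szu n : n <= size (u n).
  by elim: n => // n IHn; apply: leq_ltn_trans (szS n).
have tpre a b : a <= b -> prefix (mkseq t a) (mkseq t b).
  move=> ab; rewrite /mkseq -(subnKC ab) iotaD map_cat; exact: prefix_prefix.
split=> // N pN.
have exn : exists n, N <= size (u n) by exists N.
case: (ex_minnP exn) => -[|n] leN minn.
  by exists 0; rewrite u0 in leN *; move: leN; rewrite leqn0 => /eqP->.
exists n.+1; have ltN : size (u n) < N.
  by rewrite ltnNge; apply/negP => /minn; rewrite ltnn.
have [_ pu min] := uS n.
have eqr : rcons (u n) (x n) = mkseq t (size (u n)).+1.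
  have := pu; rewrite prefixE size_rcons => /eqP <-.
  rewrite [u n.+1 in LHS]ut /mkseq -map_take take_iota.
  by rewrite (minn_idPl (szS n)).
suff -> : N = size (u n.+1) by rewrite -ut.
apply/eqP; rewrite eqn_leq leN /=.
by have := min _ pN; rewrite size_mkseq; apply; rewrite eqr tpre.
Qed.

End Episturmian.

(* Main.v *)
(* Write psi_c for the substitution c -> c, b -> cb (b <> c). By Justin's
   formula the standard episturmian word t with directive word x_0 x_1 ... is
   psi_(x_0)(t'), where t' is directed by x_1 x_2 .... A square of period m in s
   is extended to a left-maximal repetition and desubstituted, one directive
   letter at a time, until the two occurrences of the repeated word in t_J
   become empty and are followed by distinct letters. At that stage m is the
   length of psi_(x_0) ... psi_(x_(J-1))(y), for y the factor of t_J between the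
   two occurrences, and m <= |u_J|. In t_J every letter other than c = x_J is
   isolated, so y is a power of c, a single letter, or long; the lengths
   |psi_(x_0) ... psi_(x_(J-1))(b)| have a closed form in terms of the |s_n|,
   the bound |u_J| < 2 |s_n| at the start of the block of s_n excludes the long
   factors, and the remaining lengths are those in the sets D_i(n). *)

Require Import Defs.
From mathcomp Require Import all_boot all_order all_algebra.
From mathcomp Require Import zify.
From mathcomp Require boolp.

Set Implicit Arguments.
Unset Strict Implicit.
Unset Printing Implicit Defensive.

(** * Palindromic closure and the substitutions psi *)

Section Psi.

Variables (T : eqType) (a : T).
Implicit Types (b c : T) (v w p : seq T).

Definition psi w : seq T :=
  flatten [seq if b == a then [:: a] else [:: a; b] | b <- w].

(** Every block of [psi] begins with [a]; the closing [a] makes the map commute with reversal. *)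
Definition phi w : seq T := rcons (psi w) a.

Lemma psi_cons b w :
  psi (b :: w) = if b == a then a :: psi w else a :: b :: psi w.
Proof. by rewrite /psi /=; case: eqP. Qed.

Lemma psi_cat v w : psi (v ++ w) = psi v ++ psi w.
Proof. by rewrite /psi map_cat flatten_cat. Qed.

Lemma phi_cons b w :
  phi (b :: w) = if b == a then a :: phi w else a :: b :: phi w.
Proof. by rewrite /phi psi_cons; case: eqP. Qed.

Lemma phi_head w : exists w', phi w = a :: w'.
Proof.
case: w => [|b w]; first by exists [::].
by rewrite phi_cons; case: eqP => _; eexists.
Qed.

Lemma psi_rev w : a :: rev (psi w) = phi (rev w).
Proof.
elim: w => [|b w IHw] //; rewrite rev_cons -cats1 /phi psi_cat rcons_cat.
rewrite -/(phi _) psi_cons phi_cons /=; case: eqP => _.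
  by rewrite rev_cons -rcons_cons IHw /phi -!cats1 -catA.
by rewrite !rev_cons -!rcons_cons IHw /phi -!cats1 -!catA.
Qed.

Lemma phi_rev w : phi (rev w) = rev (phi w).
Proof. by rewrite -psi_rev /phi rev_rcons. Qed.

Lemma phi_inj : injective phi.
Proof.
elim=> [|b v IHv] [|c w] //; rewrite ?phi_cons.
- by have [w' ->] := phi_head w; case: eqP.
- by have [w' ->] := phi_head v; case: eqP.
- case: eqP => [->|nb]; case: eqP => [->|nc].
  + by case=> /IHv->.
  + by have [w' ->] := phi_head v => -[/esym].
  + by have [w' ->] := phi_head w => -[].
  + by case=> -> /IHv->.
Qed.

Definition separated : rel T := [rel b c | (b == a) || (c == a)].

Lemma phi_separated w : sorted separated (phi w).
Proof.
elim: w => [|b w IHw] //; rewrite phi_cons.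
have [w' E] := phi_head w; move: IHw; rewrite E /=.
by case: eqP => _ /= ->; rewrite /separated /= eqxx ?orbT.
Qed.

(** An [a] followed by [a] decodes to [a]; an [a] followed by another letter decodes to that letter,
    after which separation forces a new [a]. *)
Lemma phi_surj p : sorted separated p -> head a p = a -> last a p = a ->
  p != [::] -> exists p', p = phi p'.
Proof.
have [n] := ubnP (size p); elim: n p => // n IHn [|b [|c p]] //= szp.
  by move=> _ -> _ _; exists [::].
move=> /andP[_ sp] -> lp _.
have [ca|nc] := eqVneq c a.
  have [p' E] : exists p', c :: p = phi p' by apply: IHn => //=.
  by exists (a :: p'); rewrite phi_cons eqxx E.
case: p sp lp szp => [_ /= E|e p /= /andP[sce sp] lp szp].
  by rewrite E eqxx in nc.
have ea : e = a by move: sce; rewrite /separated /= (negbTE nc) => /eqP.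
have [p' E] : exists p', e :: p = phi p' by apply: IHn => //=; lia.
by exists (c :: p'); rewrite phi_cons (negbTE nc) E.
Qed.

(** The last letter of [phi w] opens the next block of [phi p], and the letter after it identifies
    that block. *)
Lemma prefix_phi_inv w b p :
  prefix (rcons (phi w) b) (phi p) -> prefix (rcons w b) p.
Proof.
elim: w p => [|c w IHw] [|e p].
- by rewrite /phi /= andbF.
- rewrite phi_cons /phi /=; have [ea|ne] := eqVneq e a.
    have [p' E] := phi_head p; rewrite /= eqxx -/(phi p) E /=.
    move=> /andP[/eqP-> _].
    by rewrite ea eqxx prefix0s.
  by rewrite /= eqxx /= => /andP[-> _]; rewrite prefix0s.
- by rewrite phi_cons; have [w' E] := phi_head w; case: eqP => _;
    rewrite E /phi /= ?andbF.
- rewrite !phi_cons; have [w' Ew] := phi_head w; have [p' Ep] := phi_head p.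
  case: (eqVneq c a) => [->|nc]; case: (eqVneq e a) => [->|ne].
  + by rewrite rcons_cons /= eqxx => /= /IHw ->.
  + by rewrite Ew /= eqxx /= eq_sym (negbTE ne).
  + by rewrite Ep /= eqxx /= (negbTE nc).
  + by rewrite !rcons_cons /= eqxx /= => /andP[-> /IHw ->].
Qed.

Lemma prefix_phi w b v :
  prefix (rcons w b) v -> prefix (rcons (phi w) b) (phi v).
Proof.
case/prefixP=> z ->; rewrite cat_rcons {2}/phi psi_cat rcons_cat -/(phi _).
have -> : rcons (phi w) b = psi w ++ [:: a; b] by rewrite /phi -!cats1 -catA.
rewrite phi_cons; have [z' E] := phi_head z; apply/prefixP.
case: (eqVneq b a) => [->|nb]; last by exists (phi z); rewrite -catA.
by rewrite E; exists z'; rewrite -catA.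
Qed.

Lemma size_psi_cat v w : size (psi (v ++ w)) = size (psi v) + size (psi w).
Proof. by rewrite psi_cat size_cat. Qed.

Lemma size_psi_rev w : size (psi (rev w)) = size (psi w).
Proof.
by have := congr1 size (psi_rev w); rewrite /= size_rev size_rcons => -[].
Qed.

Lemma size_psi_prefix v w : prefix v w -> size (psi v) <= size (psi w).
Proof. by case/prefixP=> z ->; rewrite size_psi_cat leq_addr. Qed.

End Psi.

Section PalClosure.

Variable T : eqType.
Implicit Types (v w p : seq T).

Lemma palindrome_tail w p : palindrome p -> prefix w p ->
  size p <= 2 * size w -> p = w ++ rev (take (size p - size w) w).
Proof.
move=> + wp; case/prefixP: wp => z ->.
rewrite /palindrome size_cat addKn => pp szp.
congr (_ ++ _); rewrite -[z in LHS]revK; congr rev.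
have := congr1 (take (size z)) pp; rewrite rev_cat take_size_cat ?size_rev //.
by move=> ->; rewrite takel_cat //; lia.
Qed.

Lemma size_pal_closure w b v : is_pal_closure (rcons w b) v ->
  size v <= (2 * size w).+1.
Proof.
case=> _ _ /(_ (rcons w b ++ rev w)); rewrite size_cat size_rcons size_rev.
have -> : (size w).+1 + size w = (2 * size w).+1 by lia.
apply; last exact: prefix_prefix.
by rewrite /palindrome rev_cat revK rev_rcons cat_rcons.
Qed.

Lemma pal_closure_uniq w b v v' :
  is_pal_closure (rcons w b) v -> is_pal_closure (rcons w b) v' -> v = v'.
Proof.
move=> cv cv'; have sv := size_pal_closure cv; have sv' := size_pal_closure cv'.
case: cv cv' => [pv wv mv] [pv' wv' mv'].
have E : size v = size v' by apply/eqP; rewrite eqn_leq mv // mv'.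
rewrite (palindrome_tail pv wv) 1?(palindrome_tail pv' wv') ?E //;
  by rewrite size_rcons; lia.
Qed.

(** The prefix [w] and its mirror image cover every pair of adjacent letters of [p], and [separated]
    is symmetric. *)
Lemma separated_palindrome (a : T) w p : palindrome p -> prefix w p ->
  size p < 2 * size w -> sorted (separated a) w -> sorted (separated a) p.
Proof.
move=> pp wp szp /(sortedP a) sw; apply/(sortedP a) => i szi.
have nw z : z < size w -> nth a p z = nth a w z.
  by move=> zw; case/prefixP: wp => r ->; rewrite nth_cat zw.
case: (ltnP i.+1 (size w)) => [lt|ge].
  by rewrite !nw ?(ltnW lt) //; apply: sw.
have np z : z < size p -> nth a p z = nth a p (size p - z.+1).
  by move=> zp; rewrite -{1}pp nth_rev.
rewrite (np i) 1?(np i.+1) ?(ltnW szi) //.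
have -> : size p - i.+1 = (size p - i.+2).+1 by lia.
have lt : (size p - i.+2).+1 < size w by lia.
rewrite !nw ?(ltnW lt) //; have := sw _ lt.
by rewrite /separated /= orbC.
Qed.

(* The inductive step of Justin's formula u_(n+1) = psi_a(u'_n) a. *)
Lemma pal_closure_phi (a : T) w b v : is_pal_closure (rcons w b) v ->
  is_pal_closure (rcons (phi a w) b) (phi a v).
Proof.
move=> cv; have sv := size_pal_closure cv; case: cv => pv wv mv.
split; first by rewrite /palindrome -phi_rev pv.
  exact: prefix_phi.
have tv : v = rcons w b ++ rev (take (size v - (size w).+1) w).
  rewrite {1}(palindrome_tail pv wv) ?size_rcons; last by lia.
  by congr (_ ++ rev _); rewrite -cats1 takel_cat //; lia.
(* A palindrome twice as long as its prefix exceeds [phi a v]; a shorter one is separated, hence the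
   image of a palindrome competing with [v]. *)
move=> p pp wp.
have szphi : size (phi a v) < 2 * size (rcons (phi a w) b).
  rewrite tv /phi !size_rcons size_psi_cat size_psi_rev.
  have := size_psi_prefix a (prefix_take w (size v - (size w).+1)).
  have : size (psi a (rcons w b)) <= (size (psi a w)).+2.
    by rewrite -cats1 size_psi_cat psi_cons; case: eqP => _ /=; lia.
  by lia.
case: (ltnP (size p) (2 * size (rcons (phi a w) b))) => [szp|]; last by lia.
have sW : sorted (separated a) (rcons (phi a w) b).
  have /prefixP[z E] := prefix_phi a (prefix_refl (rcons w b)).
  by have := phi_separated a (rcons w b); rewrite E => /cat_sorted2[].
have sp := separated_palindrome pp wp szp sW.
have [w' Ew] := phi_head a w.
have hp : head a p = a by case/prefixP: wp => r ->; rewrite Ew.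
have p0 : p != [::] by case/prefixP: wp => r ->; rewrite Ew.
have lp : last a p = a.
  by rewrite -pp; case: (p) hp => //= e q ->; rewrite rev_cons last_rcons.
have [p' Ep] := phi_surj sp hp lp p0.
have pp' : palindrome p'.
  by apply: (@phi_inj _ a); rewrite phi_rev -Ep pp.
have wp' : prefix (rcons w b) p' by apply: (@prefix_phi_inv _ a); rewrite -Ep.
rewrite Ep /phi !size_rcons ltnS.
(* This alone does not compare the images, whose blocks have one or two letters; the tails beyond
   [rcons w b] are compared instead. *)
have szp' := mv _ pp' wp'.
move: tv; set l := size v - _ => tv.
have lw : l <= size w by rewrite /l; lia.
case/prefixP: (wp') => z Ez.
have szz : l <= size z.
  by move: szp'; rewrite Ez tv !size_cat size_rev size_takel //; lia.
(* The last [l] letters of the palindrome [p'] mirror its first [l] letters. *)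
have Ezz : prefix (take l w) (rev z).
  have : take l (rev p') = take l w.
    by rewrite pp' Ez -cats1 -catA takel_cat.
  rewrite Ez rev_cat takel_cat ?size_rev // => <-.
  exact: prefix_take.
rewrite {1}tv Ez !size_psi_cat leq_add2l size_psi_rev -(size_psi_rev a z).
exact: size_psi_prefix.
Qed.

End PalClosure.

(** * Desubstitution of standard episturmian words *)

Section Desubstitution.

Variable T : eqType.

(* [t] is the image of [t'] under psi_c, the block of the [z]-th letter of
   [t'] starting at position [p z]. *)
Definition psi_image (c : T) (t' t : nat -> T) (p : nat -> nat) : Prop :=
  [/\ p 0 = 0, forall z, p z.+1 = (p z).+1 + (t' z != c),
      forall z, t (p z) = c & forall z, t (p z).+1 = t' z].

Lemma nth_phi (c x0 : T) w z : z < size w ->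
  nth x0 (phi c w) (size (psi c (take z w))) = c /\
  nth x0 (phi c w) (size (psi c (take z w))).+1 = nth x0 w z.
Proof.
elim: w z => [|b w IHw] [|z] //= zw.
  have [w' E] := phi_head c w.
  by rewrite phi_cons; case: eqP => [->|_]; rewrite ?E.
have [h1 h2] := IHw z zw.
by rewrite phi_cons psi_cons; case: eqP => [_|_] /=.
Qed.

(** By uniqueness of closures, the palindromic prefixes of [t] are the images under [phi] of those
    of the word [t'] with shifted directive word. *)
Lemma desubstitute (x t : nat -> T) : standard_episturmian x t ->
  exists t' p, standard_episturmian (fun z => x z.+1) t' /\
    psi_image (x 0) t' t p.
Proof.
case=> u [u0 uS ut _].
have [t' et'] := standard_episturmian_exists (fun z => x z.+1).
case: (et') => v [v0 vS vt' vlim]; set c := x 0.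
have uv n : u n.+1 = phi c (v n).
  elim: n => [|n IHn].
    have := uS 0; rewrite u0 v0 => h; apply: (@pal_closure_uniq _ [::] c _ _ h).
    split=> //; first by apply: prefix_refl.
    by move=> v' _ /size_prefix.
  apply: (@pal_closure_uniq _ (phi c (v n)) (x n.+1)).
    by rewrite -IHn.
  exact: pal_closure_phi.
exists t', (fun z => size (psi c (mkseq t' z))); split=> //.
have szphi z : psi c (mkseq t' z.+1) =
    psi c (mkseq t' z) ++ psi c [:: t' z].
  by rewrite -psi_cat cats1 -mkseqS.
have tz z : t (size (psi c (mkseq t' z))) = c /\
            t (size (psi c (mkseq t' z))).+1 = t' z.
  have [n0 /(_ n0 (leqnn _)) [szv tkv]] := vlim z.+1.
  have [_ Ev] := vt' n0; have [_ Eu] := ut n0.+1.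
  have tk : take z (v n0) = mkseq t' z.
    by rewrite Ev /mkseq -map_take take_iota (minn_idPl (ltnW szv)).
  have [h1 h2] := nth_phi c c szv; move: h1 h2; rewrite tk.
  have lt : (size (psi c (mkseq t' z))).+1 < size (u n0.+1).
    rewrite uv /phi size_rcons ltnS -(cat_take_drop z.+1 (v n0)) tkv.
    rewrite size_psi_cat szphi size_cat psi_cons.
    by case: eqP => _ /=; lia.
  rewrite -uv Eu !nth_mkseq ?(ltnW lt) // => -> ->.
  by rewrite Ev nth_mkseq.
split=> // [z|z|z].
- rewrite szphi size_cat psi_cons; case: eqP => _ /=; lia.
- by case: (tz z).
- by case: (tz z).
Qed.

End Desubstitution.

(** * Repetitions *)

Section PsiImage.

Variables (T : eqType) (c : T) (t' t : nat -> T) (p : nat -> nat).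
Hypothesis tP : psi_image c t' t p.

Lemma psi_image_pos j : (exists i, j = p i) \/
  (exists2 i, j = (p i).+1 & t' i != c).
Proof.
case: tP => p0 pS _ _; elim: j => [|j [[i ->]|[i -> nc]]].
- by left; exists 0.
- case: (eqVneq (t' i) c) => [e|nc]; last by right; exists i.
  by left; exists i.+1; rewrite pS e eqxx addn0.
- by left; exists i.+1; rewrite pS nc addn1.
Qed.

Lemma psi_image_start j : t j = c -> exists i, j = p i.
Proof.
case: tP => p0 pS tp tpS; case: (psi_image_pos j) => // -[i -> nc].
by rewrite tpS => e; rewrite e eqxx in nc.
Qed.

Lemma psi_image0 : t 0 = c.
Proof. by case: tP => p0 _ tp _; rewrite -(tp 0) p0. Qed.

Lemma psi_image_next j : t j != c -> t j.+1 = c.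
Proof.
case: tP => p0 pS tp tpS; case: (psi_image_pos j) => -[i ->].
  by rewrite tp eqxx.
by move=> nc _; rewrite -(tp i.+1) pS nc addn1.
Qed.

Lemma psi_image_prev j : t j.+1 != c -> t j = c.
Proof.
by move=> nc; apply/eqP/contraT => /psi_image_next/eqP; rewrite (negbTE nc).
Qed.

Lemma psi_image_last i : 0 < p i.+1 /\ t (p i.+1).-1 = t' i.
Proof.
case: tP => p0 pS tp tpS; rewrite pS addSn; split=> //=.
by case: (eqVneq (t' i) c) => [->|nc]; rewrite ?addn0 ?tp // addn1 tpS.
Qed.

Lemma psi_image_mono : {mono p : i i' / i < i'}.
Proof.
case: tP => p0 pS _ _.
have h i e : p i < p (i + e).+1.
  elim: e => [|e IHe]; first by rewrite addn0 pS; lia.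
  by apply: leq_trans IHe _; rewrite addnS [p (_.+2)]pS; lia.
move=> i i'; case: (ltnP i i') => [lt|].
  by have := h i (i' - i.+1); rewrite -addnS subnSK // subnKC // ltnW.
rewrite leq_eqVlt => /predU1P[->|lt]; first by rewrite ltnn.
apply/negbTE; rewrite -leqNgt ltnW //.
by have := h i' (i - i'.+1); rewrite -addnS subnSK // subnKC // ltnW.
Qed.

(** With [F] the function [ret_len J] and [c = x J], the right summand is [ret_len J.+1]:
    desubstitution preserves total length. *)
Lemma psi_image_sum (F : T -> nat) i e :
  \sum_(p i <= z < p (i + e)) F (t z) =
  \sum_(i <= z < i + e) (F (t' z) + (t' z != c) * F c).
Proof.
case: (tP) => p0 pS tp tpS; elim: e => [|e IHe].
  by rewrite addn0 !big_geq.
have le z : p z <= p z.+1 by rewrite pS; lia.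
have le' : p i <= p (i + e).
  elim: (e) => [|e' IH]; rewrite ?addn0 ?addnS //.
  exact: leq_trans IH (le _).
rewrite addnS (big_cat_nat le' (le _)) /= IHe big_nat_recr ?leq_addr //=.
congr (_ + _); rewrite pS.
case: (eqVneq (t' (i + e)) c) => [->|nc] /=.
  by rewrite addn0 big_nat1 tp addn0.
rewrite addn1 big_nat_recr ?leqnSn // big_nat1 /= tp tpS.
by rewrite mul1n addnC.
Qed.

(** The letter after a block start determines the block, so at most one agreeing letter, the [c]
    opening the next block, stays undecoded. *)
Lemma psi_image_agree i i' l :
  (forall z, z < l.+1 -> t (p i + z) = t (p i' + z)) ->
  exists e r : nat, [/\ forall z, z < e -> t' (i + z) = t' (i' + z),
    p (i + e) = p i + r, p (i' + e) = p i' + r & r = l \/ r = l.+1].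
Proof.
case: (tP) => p0 pS tp tpS; elim: l => [|l IHl] agr.
  by exists 0, 0; rewrite !addn0; split=> //; left.
have [z zl|e [r [ae pe pe' rl]]] := IHl; first by apply: agr; apply: ltnW.
case: rl => rl; last by exists e, r; split=> //; left.
have E : t' (i + e) = t' (i' + e).
  by rewrite -!tpS pe pe' rl -!addnS agr.
exists e.+1, (r.+1 + (t' (i + e) != c)); split.
- by move=> z; rewrite ltnS leq_eqVlt => /predU1P[->|/ae].
- by rewrite addnS pS pe; lia.
- by rewrite addnS pS pe' E; lia.
- by rewrite rl; case: (_ != c); lia.
Qed.

End PsiImage.

Lemma leq_sum_nat3 (F : nat -> nat) a b c i j : i <= a -> a < b -> b < c ->
  c < j -> F a + F b + F c <= \sum_(i <= z < j) F z.
Proof.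
move=> ia ab bc cj.
have ge1 u v w : u <= v -> v < w -> F v <= \sum_(u <= z < w) F z.
  move=> uv vw; rewrite (big_cat_nat uv (ltnW vw)) /= (big_ltn vw).
  by rewrite addnCA leq_addr.
rewrite (@big_cat_nat _ _ _ b i j) /=; [|lia|lia].
rewrite (@big_cat_nat _ _ _ b.+1 b j) /=; [|lia|lia].
rewrite big_nat1 -addnA; apply: leq_add; first exact: ge1.
by apply: leq_add => //; apply: ge1.
Qed.

Section Repetitions.

Variables (T : eqType) (x : nat -> T).

(* With psi_J the composite of the substitutions attached to x_0, ..., x_(J-1),
   [ret_len J b] is the length of psi_J(b), which is the length of a return
   word of the palindromic prefix u_J; [pal_len J] is the length of u_J. *)
Fixpoint ret_len (J : nat) (b : T) : nat :=
  if J is J'.+1 then ret_len J' b + (b != x J') * ret_len J' (x J') else 1.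

Fixpoint pal_len (J : nat) : nat :=
  if J is J'.+1 then pal_len J' + ret_len J' (x J') else 0.

Lemma ret_len_mono J I b : J <= I -> ret_len J b <= ret_len I b.
Proof.
move=> /subnKC <-; elim: (I - J) => [|e IHe]; rewrite ?addn0 // addnS /=.
by apply: leq_trans IHe (leq_addr _ _).
Qed.

(** The factor between the two occurrences is, in order: a power of [x J]; a word with ends [x J]
    and another letter inside; a single other letter; a longer word whose ends differ from [x J]. *)
Variant square_period (m J : nat) : Prop :=
| PeriodPower f of 0 < f & m = f * ret_len J (x J)
| PeriodLongIn b of b != x J & ret_len J b + 2 * ret_len J (x J) <= m
| PeriodLetter b of b != x J & m = ret_len J b
| PeriodLongOut b b' of b != x J & b' != x J
    & ret_len J b + ret_len J b' + ret_len J (x J) <= m.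

(** If [t j = x J], then [t j' <> x J] forces the factor to end with [x J]. Otherwise [x J] precedes
    the factor, and left-maximality makes it end with another letter. *)
Lemma bispecial_period t j j' J :
  standard_episturmian (fun z => x (J + z)) t -> j < j' ->
  t j <> t j' -> (j = 0 \/ t j.-1 <> t j'.-1) ->
  square_period (\sum_(j <= z < j') ret_len J (t z)) J.
Proof.
move=> /desubstitute[t' [p [_]]]; rewrite addn0 => tP.
case: j' => // j' jj' ne lft.
case: (eqVneq (t j) (x J)) => [tj|ntj].
  have ntj' : t j'.+1 != x J by apply/eqP => e; apply: ne; rewrite tj.
  have tj' := psi_image_prev tP ntj'.
  case: (boolP (all (fun z => t z == x J) (index_iota j j'.+1))) => [/allP al|].
    apply: (@PeriodPower _ _ (j'.+1 - j)); first by rewrite subn_gt0.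
    rewrite -sum_nat_const_nat; apply: eq_big_nat => z zj.
    by congr ret_len; apply/eqP/al; rewrite mem_index_iota.
  rewrite -has_predC => /hasP[z].
  rewrite mem_index_iota /= => /andP[jz zj'] ntz.
  apply: (@PeriodLongIn _ _ (t z)) => //.
  have zj : z <> j by move=> e; rewrite e tj eqxx in ntz.
  have zj1 : z <> j' by move=> e; rewrite e tj' eqxx in ntz.
  have := @leq_sum_nat3 (fun z => ret_len J (t z)) j z j' j j'.+1.
  by rewrite tj tj' => h; apply: leq_trans (h _ _ _ _); lia.
case: j jj' ne lft ntj => [|j] jj' ne lft ntj.
  by rewrite (psi_image0 tP) eqxx in ntj.
have tj := psi_image_prev tP ntj.
have ntj' : t j' != x J by case: lft => // /eqP; rewrite /= tj eq_sym.
case: (eqVneq j' j.+1) => [->|nj].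
  by rewrite big_nat1; apply: (@PeriodLetter _ _ (t j.+1)).
have tj2 := psi_image_next tP ntj.
have nj2 : j' <> j.+2 by move=> e; rewrite e tj2 eqxx in ntj'.
apply: (@PeriodLongOut _ _ (t j.+1) (t j')) => //.
have := @leq_sum_nat3 (fun z => ret_len J (t z)) j.+1 j.+2 j' j.+1 j'.+1.
by rewrite tj2 addnAC => h; apply: h; lia.
Qed.

(* Desubstitutes a left-maximal repetition of period [m], until it cannot be
   extended to the right either. *)
Lemma repetition_period m B : (forall b, m < ret_len B b) ->
  forall e J t j j' l, B - J <= e ->
  standard_episturmian (fun z => x (J + z)) t ->
  j < j' -> (j = 0 \/ t j.-1 <> t j'.-1) ->
  (forall z, z < l -> t (j + z) = t (j' + z)) ->
  m = \sum_(j <= z < j') ret_len J (t z) ->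
  m <= pal_len J + \sum_(j <= z < j + l) ret_len J (t z) ->
  exists2 I, m <= pal_len I & square_period m I.
Proof.
move=> mB; elim=> [|e IHe] J t j j' l BJ et jj' lft agr Em lem.
  (* Once [J >= B], the single letter [t j] already weighs more than [m]. *)
  have := mB (t j); rewrite {1}Em (big_ltn jj').
  have : ret_len B (t j) <= ret_len J (t j) by apply: ret_len_mono; lia.
  by lia.
wlog El : l agr lem / (exists l', l = l'.+1) \/ (l = 0 /\ t j <> t j').
  move=> H; case: l agr lem => [|l] agr lem.
    case: (eqVneq (t j) (t j')) => [E|/eqP ne].
      apply: (H 1) => //; last by left; exists 0.
        by case=> // _; rewrite !addn0.
      rewrite addn0 big_geq // addn0 in lem.
      exact: leq_trans lem (leq_addr _ _).
    by apply: (H 0) => //; right.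
  by apply: (H l.+1) => //; left; exists l.
- case: El => [[l' El]|[l0 ne]]; last first.
    exists J; first by move: lem; rewrite l0 addn0 big_geq // addn0.
    by rewrite {1}Em; apply: bispecial_period.
  subst l; have [t' [p [et' tP]]] := desubstitute et; rewrite addn0 in tP.
  have E : t j = t j' by have := agr 0; rewrite !addn0; apply.
  (* Otherwise [x J] would precede both occurrences, against left-maximality; at position 0 the word
     starts with [x J]. *)
  have tj : t j = x J.
    apply/eqP/contraT => ntj; have ntj' : t j' != x J by rewrite -E.
    case: (j) (j') jj' lft ntj ntj' => [|i] [|i'] // _.
      by rewrite (psi_image0 tP) eqxx.
    case=> // ne /(psi_image_prev tP) E1 /(psi_image_prev tP) E2.
    by rewrite /= E1 E2 in ne.
  have [i Ei] := psi_image_start tP tj.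
  have [i' Ei'] := psi_image_start tP (etrans (esym E) tj).
  subst j j'; rewrite (psi_image_mono tP) in jj'.
  have [e0 [r [agr' pe _ rl]]] := psi_image_agree tP agr.
  have sumJ a b : a <= b -> \sum_(p a <= z < p b) ret_len J (t z) =
      \sum_(a <= z < b) ret_len J.+1 (t' z).
    by move/subnKC <-; rewrite (psi_image_sum tP).
  apply: (IHe J.+1 t' i i' e0) => //; first by lia.
  - have Ef : (fun z => x (J + z.+1)) = (fun z => x (J.+1 + z)).
      by apply/boolp.funext => z; rewrite addnS.
    by rewrite -Ef.
  - case: (i) (i') jj' lft => [|h] [|h'] // _; first by left.
    have [h0 hl] := psi_image_last tP h; have [h0' hl'] := psi_image_last tP h'.
    by case=> [e1|]; [rewrite e1 in h0 | rewrite hl hl'; right].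
  - by rewrite Em sumJ // ltnW.
  (* An undecoded last letter costs the repeated word the weight of [x J], which is exactly what
     [pal_len] gains. *)
  - rewrite -sumJ ?leq_addr // pe; case: rl pe => -> El0; last first.
      by apply: leq_trans lem _; rewrite leq_add2r /= leq_addr.
    move: lem; rewrite addnS big_nat_recr ?leq_addr //=.
    rewrite -El0.
    by case: tP => _ _ -> _; rewrite addnA addnAC.
Qed.

End Repetitions.

(** * Lengths *)

Section Blocks.

Variable d : nat -> nat.
Hypothesis hd : forall j : nat, 1 <= j -> 1 <= d j.

(** The position, counted from 0, where the run of [d n.+1] copies of [letter n] begins in the
    directive word. *)
Definition block_start (n : nat) : nat := \sum_(1 <= j < n.+1) d j.

Lemma block_startS n : block_start n.+1 = block_start n + d n.+1.
Proof. by rewrite /block_start big_nat_recr. Qed.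

Lemma block_start_ge n : n <= block_start n.
Proof.
elim: n => // n IHn; rewrite block_startS; have := hd (ltn0Sn n); lia.
Qed.

Lemma block_decomposition J : exists n q, q < d n.+1 /\ J = block_start n + q.
Proof.
elim: J => [|J [n [q [qd ->]]]].
  by exists 0, 0; rewrite /block_start big_geq // hd.
case: (ltnP q.+1 (d n.+1)) => qd'; first by exists n, q.+1; rewrite addnS.
by exists n.+1, 0; rewrite hd // block_startS; split=> //; lia.
Qed.

End Blocks.

Section Lengths.

Variables (k : nat) (hk : 1 < k) (d : nat -> nat).
Hypothesis hd : forall j : nat, 1 <= j -> 1 <= d j.

Local Notation letter := (letter hk).

Lemma size_wpow (T : Type) (w : seq T) l : size (wpow w l) = l * size w.
Proof.
by rewrite /wpow; elim: l => // l IHl; rewrite /= size_cat IHl mulSn.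
Qed.

Definition slen (n : nat) : nat := size (sword hk d n).

(* The length of s_(n-1)^(d_n) ... s_(n-i+1)^(d_(n-i+2)) s_(n-i). *)
Definition tail_len (n i : nat) : nat :=
  size (sprod hk d n i.-1) + size (sword hk d (n%:Z - i%:Z)%R).

(** By [ret_len_block] this is [pal_len] at [block_start d n]. *)
Definition block_pal_len (n : nat) : nat := size (sprod hk d n n).

Lemma size_sprodS n c :
  size (sprod hk d n.+1 c.+1) = d n.+1 * slen n + size (sprod hk d n c).
Proof.
rewrite /sprod /= size_cat size_wpow; congr (_ + _).
  by rewrite addn1 !subn1.
rewrite -[2]/(1 + 1) iotaDl -map_comp; congr (size (flatten _)).
apply: eq_map => j /=; congr (wpow (sword _ _ _) (dz _ _)); lia.
Qed.

Lemma size_sprod0 c : size (sprod hk d 0 c) = 0.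
Proof.
rewrite /sprod size_flatten /shape -map_comp sumnE big_map big_seq big1 // => j.
rewrite mem_iota => /andP[j1 _] /=; rewrite size_wpow.
case E: (_ + _ - _)%R => [[|z]|z] //=; lia.
Qed.

Lemma tail_len0 i : tail_len 0 i.+1 = 1.
Proof.
rewrite /tail_len size_sprod0.
by have -> : (0%:Z - i.+1%:Z = Negz i)%R by lia.
Qed.

Lemma tail_lenS1 n : tail_len n.+1 1 = slen n.
Proof. by rewrite /tail_len; have -> : (n.+1%:Z - 1%:Z = n%:Z)%R by lia. Qed.

Lemma tail_lenSS n i :
  tail_len n.+1 i.+2 = d n.+1 * slen n + tail_len n i.+1.
Proof.
rewrite /tail_len /= size_sprodS -addnA.
by congr (_ + (_ + size (sword _ _ _))).
Qed.

Lemma block_pal_lenS n :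
  block_pal_len n.+1 = d n.+1 * slen n + block_pal_len n.
Proof. exact: size_sprodS. Qed.

(** The final word has negative index, hence length 1, and the exponents of index at most 0 vanish.
    This is the case of letters absent from the first [n] blocks. *)
Lemma tail_len_unseen n i : n <= i -> tail_len n i.+1 = (block_pal_len n).+1.
Proof.
elim: n i => [|n IHn] i; first by rewrite tail_len0 /block_pal_len size_sprod0.
by case: i => // i ni; rewrite tail_lenSS IHn // block_pal_lenS addnS.
Qed.

Lemma slenE n : slen n = tail_len n k.
Proof.
case: (ltnP n k) => nk.
  have -> : k = k.-1.+1 by lia.
  rewrite tail_len_unseen; last by lia.
  case: n nk => [|n] nk; first by rewrite /block_pal_len size_sprod0.
  rewrite /slen sword_small; last by lia.
  by rewrite size_cat /= addn1.
by rewrite /slen sword_large // size_cat subn1.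
Qed.

Lemma tail_len_gt0 n i : 0 < tail_len n i.+1.
Proof.
elim: n i => [|n IHn] i; first by rewrite tail_len0.
case: i => [|i]; last by rewrite tail_lenSS addn_gt0 IHn orbT.
by rewrite tail_lenS1 slenE; have -> : k = k.-1.+1 by lia.
Qed.

Lemma tail_len_leS n i : tail_len n i.+1 <= tail_len n i.+2.
Proof.
elim: n i => [|n IHn] i; first by rewrite !tail_len0.
case: i => [|i]; last by rewrite !tail_lenSS leq_add2l.
rewrite tail_lenS1 tail_lenSS; have := hd (ltn0Sn n).
by case: (d n.+1) => // e _; rewrite mulSn -addnA leq_addr.
Qed.

Lemma tail_len_le n i i' : 0 < i <= i' -> tail_len n i <= tail_len n i'.
Proof.
case: i => // i /andP[_ /subnKC <-]; elim: (_ - _) => [|e IHe].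
  by rewrite addn0.
by apply: leq_trans IHe _; rewrite addnS addSn tail_len_leS.
Qed.

Lemma tail_len_lt n i : i < n -> tail_len n i.+1 < tail_len n i.+2.
Proof.
elim: n i => [|n IHn] [|i] // lin; last by rewrite !tail_lenSS ltn_add2l IHn.
rewrite tail_lenS1 tail_lenSS; have := hd (ltn0Sn n).
have := tail_len_gt0 n 0.
by case: (d n.+1) => // e; rewrite mulSn; lia.
Qed.

Lemma slen_gt0 n : 0 < slen n.
Proof. by rewrite slenE -(prednK (ltnW hk)) tail_len_gt0. Qed.

Lemma slenS n : slen n.+1 = d n.+1 * slen n + tail_len n k.-1.
Proof.
rewrite [slen n.+1]slenE; have -> : k = k.-2.+2 by lia.
by rewrite tail_lenSS.
Qed.

Lemma slenS_gt n : d n.+1 * slen n < slen n.+1.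
Proof.
have -> : slen n.+1 = d n.+1 * slen n + tail_len n k.-2.+1.
  by rewrite slenS prednK; lia.
by have := tail_len_gt0 n k.-2; lia.
Qed.

Lemma slen_ltS n : slen n < slen n.+1.
Proof.
apply: leq_ltn_trans (slenS_gt n); rewrite leq_pmull //; exact: hd.
Qed.

Lemma slen_mono : {homo slen : n n' / n <= n'}.
Proof.
by apply: homo_leq => // [|n]; [exact: leq_trans | exact: ltnW (slen_ltS n)].
Qed.

Lemma slen_gt n : n < slen n.
Proof. by elim: n => [|n IHn]; [exact: slen_gt0 | have := slen_ltS n; lia]. Qed.

Lemma tail_len_ge n i : slen n <= tail_len n.+1 i.+1.
Proof. by rewrite -tail_lenS1; apply: tail_len_le. Qed.

(** The full product is cut after its first [i] powers: what remains has length
    [block_pal_len n.+1], where [tail_len] has s_n instead. *)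
Lemma tail_len_block_pal_len n i :
  block_pal_len (n + i).+1 + slen n =
  tail_len (n + i).+1 i.+1 + block_pal_len n.+1.
Proof.
elim: i => [|i IHi]; first by rewrite addn0 tail_lenS1 addnC.
by rewrite addnS [block_pal_len _.+1]block_pal_lenS tail_lenSS; lia.
Qed.

(** For [n >= k] the left side is |s_n| + (d_(n-k+1) - 1)|s_(n-k)| + [block_pal_len (n - k)]; by
    induction it is below |s_n| + |s_(n-k+1)| + |s_(n-k)|, at most 2|s_n|. *)
Lemma block_pal_len_lt n : block_pal_len n < 2 * slen n.
Proof.
have [e] := ubnP n; elim: e n => // e IHe n ne.
case: (ltnP n k) => nk.
  rewrite slenE -(prednK (ltnW hk)) tail_len_unseen; last by lia.
  by lia.
have En : n = (n - k + k.-1).+1 by lia.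
have := tail_len_block_pal_len (n - k) k.-1; rewrite -En prednK; last by lia.
rewrite -slenE block_pal_lenS.
have := IHe (n - k); have := slenS_gt (n - k).
have h1 : slen (n - k).+1 + slen (n - k) <= slen n.
  have [n2 En2] : exists n2, n = n2.+2 by exists n.-2; lia.
  rewrite [X in _ <= slen X]En2 (slenS n2.+1); apply: leq_add.
    apply: (@leq_trans (slen n2.+1)); first by apply: slen_mono; lia.
    by rewrite leq_pmull //; apply: hd.
  have -> : k.-1 = k.-2.+1 by lia.
  by apply: leq_trans (tail_len_ge _ _); apply: slen_mono; lia.
by lia.
Qed.

Lemma directive_block n q : q < d n.+1 ->
  directive hk d (block_start d n + q) = letter n.
Proof.
move=> qd; rewrite /directive.
have -> : (block_start d n + q).+1 = n + (block_start d n + q - n).+1.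
  by have := block_start_ge hd n; lia.
rewrite iotaD map_cat flatten_cat nth_cat.
have -> : size (flatten [seq nseq (d j) (letter j.-1) | j <- iota 1 n]) =
    block_start d n.
  rewrite size_flatten /shape -map_comp sumnE big_map /block_start /index_iota.
  by rewrite subSS subn0; apply: eq_bigr => j _ /=; rewrite size_nseq.
rewrite ltnNge leq_addr /= addKn add1n nth_cat size_nseq qd nth_nseq qd.
by [].
Qed.

Lemma letter_eq n e : e < k -> (letter (n + e) == letter n) = (e == 0).
Proof.
move=> ek; rewrite -val_eqE /= -{2}[n]addn0 eqn_modDl mod0n modn_small //.
Qed.

Lemma letterDk n : letter (n + k) = letter n.
Proof. by apply: val_inj; rewrite /= modnDr. Qed.

Lemma letter_surj n (b : 'I_k) : exists2 e, e < k & b = letter (n + e).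
Proof.
(* As [k.-1] is -1 modulo [k], this is the residue of b - n. *)
exists ((b + k.-1 * n) %% k); first by rewrite ltn_mod; lia.
apply: val_inj; rewrite /= modnDmr addnCA -mulSn prednK; last by lia.
by rewrite addnC mulnC modnMDl modn_small.
Qed.

(** Within block [n], [letter n] keeps return length |s_n|, so each step adds |s_n| to every other
    letter and to the palindrome. *)
Lemma ret_len_in_block n :
  pal_len (directive hk d) (block_start d n) = block_pal_len n ->
  (forall e, e < k ->
    ret_len (directive hk d) (block_start d n) (letter (n + e)) =
    tail_len n (k - e)) ->
  forall q, q <= d n.+1 ->
  pal_len (directive hk d) (block_start d n + q) =
    block_pal_len n + q * slen n /\
  forall e, e < k ->
    ret_len (directive hk d) (block_start d n + q) (letter (n + e)) =
    (e != 0) * (q * slen n) + tail_len n (k - e).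
Proof.
move=> p0 r0; elim=> [_|q IHq qd].
  rewrite addn0 p0 mul0n addn0; split=> // e ek.
  by rewrite r0 // muln0.
have [IHp IHr] := IHq (ltnW qd).
have rc : ret_len (directive hk d) (block_start d n + q) (letter n) = slen n.
  by rewrite -[n in letter n]addn0 IHr ?mul0n ?subn0 -?slenE // ltnW.
rewrite addnS /= directive_block // rc IHp; split; first by rewrite mulSn; lia.
move=> e ek; rewrite letter_eq // IHr //.
by case: eqP => _ /=; rewrite ?mulSn ?mul1n ?mul0n; lia.
Qed.

(** From block to block, [letter (n.+1 + e)] is [letter (n + e.+1)], whose gains match [tail_lenSS];
    for [e = k.-1] it is [letter n] again, of length |s_n|. *)
Lemma ret_len_block n q : q <= d n.+1 ->
  pal_len (directive hk d) (block_start d n + q) =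
    block_pal_len n + q * slen n /\
  forall e, e < k ->
    ret_len (directive hk d) (block_start d n + q) (letter (n + e)) =
    (e != 0) * (q * slen n) + tail_len n (k - e).
Proof.
elim: n q => [|n IHn] q.
  apply: ret_len_in_block.
    by rewrite /block_start big_geq //= /block_pal_len size_sprod0.
  move=> e ek; rewrite /block_start big_geq //=.
  by rewrite -(prednK (_ : 0 < k - e)) ?tail_len0 // subn_gt0.
have [IHp IHr] := IHn _ (leqnn (d n.+1)).
apply: ret_len_in_block; first by rewrite block_startS IHp block_pal_lenS addnC.
move=> e ek; rewrite block_startS addSnnS.
case: (ltnP e.+1 k) => [lt|ge].
  rewrite IHr // mul1n.
  have -> : k - e = (k - e.+1).-1.+2 by lia.
  by rewrite tail_lenSS prednK // subn_gt0.
have -> : e = k.-1 by lia.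
rewrite prednK; last by lia.
rewrite letterDk -[n in letter n]addn0 IHr; last by lia.
rewrite mul0n add0n subn0 -slenE; have -> : k - k.-1 = 1 by lia.
by rewrite tail_lenS1.
Qed.

End Lengths.

(** * Periods of repetitions and the sets D_i(n) *)

Section SquarePeriods.

Variables (k : nat) (hk : 1 < k) (d : nat -> nat).
Hypothesis hd : forall j : nat, 1 <= j -> 1 <= d j.

Local Notation slen := (slen hk d).
Local Notation tail_len := (tail_len hk d).

Lemma mem_Dset1 n r : 0 < r <= d n.+1 -> r * slen n \in Dset hk d 1 n.
Proof.
move=> rd; rewrite /Dset /=; apply/mapP; exists r => //.
by rewrite mem_iota add1n ltnS.
Qed.

(** The disjunction accounts for the shorter range of [r] in D_k. *)
Lemma mem_Dset n i r : 0 < i < k -> 0 < r <= d n.+1 ->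
  i.+1 < k \/ r < d n.+1 -> r * slen n + tail_len n i \in Dset hk d i.+1 n.
Proof.
case: i => // i ik rd h; rewrite /Dset eqSS /=.
have E : r * slen n + tail_len n i.+1 = size (wpow (sword hk d n) r ++
    sprod hk d n (i.+2 - 2) ++ sword hk d (n%:Z + 1 - i.+2%:Z)%R).
  rewrite !size_cat size_wpow subn2 /=.
  by congr (_ + (_ + size (sword _ _ _))); lia.
case: ifP => ik'; apply/mapP; exists r => //; rewrite mem_iota; lia.
Qed.

Lemma square_period_mem_Dset m J : 0 < m -> m <= pal_len (directive hk d) J ->
  square_period (directive hk d) m J ->
  exists n i, [/\ slen n <= m < slen n.+1, 0 < i <= k & m \in Dset hk d i n].
Proof.
move=> m0; have [n [q [qd ->]]] := block_decomposition hd J.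
have [-> rE] := ret_len_block hk hd (ltnW qd).
have Sn := slen_gt0 hk d n; have Un := block_pal_len_lt hk hd n.
have rc : ret_len (directive hk d) (block_start d n + q) (letter hk n) = slen n.
  by rewrite -[n in letter hk n]addn0 rE ?mul0n ?subn0 -?slenE // ltnW.
have rb b : b != letter hk n -> exists i, 0 < i < k /\
    ret_len (directive hk d) (block_start d n + q) b =
    q * slen n + tail_len n i.
  have [e ek ->] := letter_surj hk n b; rewrite letter_eq // => e0.
  by exists (k - e); rewrite rE // e0 mul1n; split=> //; lia.
have lt_q z : z * slen n < (q + 2) * slen n -> z < q + 2 by rewrite ltn_pmul2r.
rewrite mulnDl in lt_q.
move=> mU; case; rewrite directive_block // ?rc.
- move=> f f0 Em; have fq : f < q + 2 by apply: lt_q; lia.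
  have fd : f <= d n.+1 by lia.
  exists n, 1; split; [|by lia|by rewrite Em mem_Dset1 ?f0].
  rewrite Em leq_pmull //=; apply: leq_ltn_trans (slenS_gt hk d n).
  by rewrite leq_mul2r fd orbT.
- by move=> b /rb[i [_ ->]] ?; lia.
- move=> b /rb[i [ik ->]] Em.
  have ti : tail_len n i <= slen n.
    by rewrite slenE; apply: tail_len_le => //; lia.
  (* For q > 0, [m] lies in D_(i+1)(n). For q = 0 it is below |s_n| and lies in D_i(n-1), with r = 1
     if i = 1 and r = d_n otherwise. *)
  case: q qd mU Em {rE rc rb lt_q} => [|q] qd mU Em; last first.
    exists n, i.+1; split; [|by lia|by rewrite Em; apply: mem_Dset; lia].
    have := slenS_gt hk d n.
    have : q.+2 * slen n <= d n.+1 * slen n by rewrite leq_mul2r qd orbT.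
    by rewrite Em !mulSn; lia.
  move: Em mU; rewrite mul0n add0n addn0 => Em mU.
  (* A letter absent from the first [n] blocks would give a period one longer than the palindromic
     prefix. *)
  have lt_in : i <= n.
    rewrite leqNgt; apply/negP => ni; move: mU; rewrite Em.
    by case: (i) ni => // j nj; rewrite tail_len_unseen //; lia.
  have m_lt : m < slen n.
    case: (i) ik lt_in Em => // j jk jn ->.
    rewrite slenE; apply: leq_trans (tail_len_lt hk hd jn) _.
    by apply: tail_len_le => //; lia.
  case: n i ik lt_in m_lt Em {qd mU Sn Un ti} => [|n] [|[|i]] //
    ik lt_in m_lt Em.
    exists n, 1; move: Em m_lt; rewrite tail_lenS1 => -> lt; split; [|by lia|].
    - by rewrite leqnn.
    - by rewrite -[slen n]mul1n mem_Dset1 //= hd.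
  exists n, i.+2; split; [|by lia|].
    by rewrite m_lt andbT Em tail_len_ge.
  by rewrite Em tail_lenSS; apply: mem_Dset; rewrite ?leqnn ?hd //; lia.
- move=> b b' /rb[i [ik ->]] /rb[i' [ik' ->]] lem.
  case: q qd mU lem {rE rc rb lt_q} => [|q] qd mU lem; last first.
    by move: lem; rewrite !mulSn; lia.
  (* For n > 0 both letters have length at least |s_(n-1)|, so [m] is at least |s_n| + 2|s_(n-1)|,
     which exceeds the palindromic prefix. *)
  exfalso; case: n qd mU lem Sn Un => [|n] qd mU lem Sn Un.
    by move: mU; rewrite /block_pal_len size_sprod0; lia.
  have := slenS_gt hk d n; have := block_pal_len_lt hk hd n.
  have := tail_len_ge hk hd n i.-1; have := tail_len_ge hk hd n i'.-1.
  move: mU lem; rewrite block_pal_lenS !prednK; lia.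
Qed.

End SquarePeriods.

(** * From powers to left-maximal repetitions *)

Lemma nth_wpow (T : Type) (x0 : T) (w : seq T) l z : z < size w ->
  nth x0 (wpow w l.+2) z = nth x0 w z /\
  nth x0 (wpow w l.+2) (size w + z) = nth x0 w z.
Proof.
move=> zw; rewrite /wpow /= !nth_cat zw; split=> //.
by rewrite ltnNge leq_addr /= addKn zw.
Qed.

(** Shifting left while the preceding letters agree lengthens the repeated word, and stops at
    position 0 at the latest. *)
Lemma left_maximal_repetition (T : eqType) (t : nat -> T) m i :
  (forall z, z < m -> t (i + z) = t (i + m + z)) ->
  exists j l, [/\ j = 0 \/ t j.-1 <> t (j + m).-1,
    forall z, z < l -> t (j + z) = t (j + m + z) & m <= l].
Proof.
move=> agr.
have : exists2 l, m <= l & forall z, z < l -> t (i + z) = t (i + m + z).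
  by exists m.
elim: i {agr} => [|i IHi] [l ml agr]; first by exists 0, l; split=> //; left.
case: (eqVneq (t i) (t (i + m))) => [E|/eqP ne]; last first.
  by exists i.+1, l; split=> //; right; rewrite addSn.
apply: IHi; exists l.+1; first exact: leqW.
case=> [_|z zl]; first by rewrite !addn0.
by rewrite -!addSnnS -addSn agr.
Qed.

Theorem theorem6p1 (k : nat) (hk : 1 < k) (d : nat -> nat)
  (hd : forall j : nat, 1 <= j -> 1 <= d j)
  (s : nat -> 'I_k) (hs : standard_episturmian (directive hk d) s)
  (m n : nat) (hm : 1 <= m) (hn : 1 <= n)
  (hmn : size (sword hk d n) <= m < size (sword hk d n.+1))
  (hD : forall i : nat, 1 <= i <= k -> m \notin Dset hk d i n) :
  forall l : nat, 2 <= l -> num_powers s m l = 0.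
Proof.
case=> [|[|l]] // _; apply/eqP; rewrite cards_eq0 -subset0; apply/subsetP => w.
rewrite inE => /boolp.asboolP[i Ew]; exfalso.
have agr z : z < m -> s (i + z) = s (i + m + z).
  move=> zm; have zw : z < size w by rewrite size_tuple.
  have [h1 h2] := nth_wpow (s 0) l zw.
  have szw : size (wpow w l.+2) = m + (m + l * m).
    by rewrite size_wpow size_tuple !mulSn.
  have nthE y : y < m + m -> nth (s 0) (wpow w l.+2) y = s (i + y).
    move=> ym; have ys : y < size (wpow w l.+2) by rewrite szw; lia.
    by rewrite Ew (nth_map 0) ?size_iota // nth_iota.
  rewrite -addnA -!nthE; [|lia|lia].
  by rewrite h1 -[X in X + z](size_tuple w) h2.
have [j [e [lft agr' me]]] := left_maximal_repetition agr.
(* After [m.+1] blocks every return length is at least |s_m|, which exceeds [m]. *)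
have B b : m < ret_len (directive hk d) (block_start d m.+1) b.
  have [f fk ->] := letter_surj hk m.+1 b.
  have [_] := ret_len_block hk hd (leq0n (d m.+2)); rewrite addn0 => -> //.
  rewrite mul0n muln0 add0n; apply: leq_trans (slen_gt hk hd m) _.
  by have := tail_len_ge hk hd m (k - f).-1; rewrite prednK // subn_gt0.
have [||||||J mJ sqJ] := repetition_period B (leqnn _) (t := s) (j := j)
    (j' := j + m) (l := e) (J := 0).
- exact: hs.
- lia.
- exact: lft.
- exact: agr'.
- by rewrite sum_nat_const_nat muln1 addKn.
- by rewrite sum_nat_const_nat muln1 addKn.
have [n' [c [/andP[le1 lt1] ck mD]]] := square_period_mem_Dset hd hm mJ sqJ.
case/andP: hmn => le2 lt2.
(* As |s_n| increases with [n], [m] lies between consecutive lengths for only one index. *)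
suff En : n' = n by have := hD _ ck; rewrite -En mD.
have mono a b : slen hk d a <= m -> m < slen hk d b.+1 -> a <= b.
  move=> ha hb; rewrite leqNgt; apply/negP => /(slen_mono hk hd).
  by rewrite leqNgt (leq_ltn_trans ha hb).
by apply/eqP; rewrite eqn_leq (mono _ _ le1 lt2) (mono _ _ le2 lt1).
Qed.
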